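(* For every fixed $k\ge1$ and $j\ge1$, \[ \alpha_{n,j}^{(k)}=-\frac{k}{n+k}+\frac{kj}{(n+k)^2}+O(n^{-3}),\qquad n\to\infty. \] Consequently, \[ \left|\alpha_{n,j}^{(k)}\right|^2-\left|\alpha_{n,j+1}^{(k)}\right|^2=\frac{2k^2}{(n+k)^3}+O(n^{-4}),\qquad n\to\infty. \]
   Context: $H^2(\mathbb D^2)$ is the Hardy space over the bidisk, in which the monomials $z^aw^b$ ($a,b\ge0$) form an orthonormal basis. For $k\ge1$ let $p_k=(z-w)^k$ and let $M_k=[p_k]$ be the closure of $p_k\mathbb C[z,w]$ in $H^2(\mathbb D^2)$. For $n\ge0$ let $A^n=\left(\langle p_kz^iw^{n-i},p_kz^jw^{n-j}\rangle\right)_{i,j=0}^n$ (a real symmetric positive definite Toeplitz matrix), let $A^n_{i,j}$ be the algebraic (signed) cofactor of its $(i,j)$ entry (indices from $0$ to $n$; $A^0_{0,0}=1$), and put $D_0=1$, $D_n=\det A^{n-1}$ for $n\ge1$. Set \[ \phi_n=\frac{\sum_{l=0}^nA^n_{0,l}\,p_kz^lw^{n-l}}{\sqrt{D_nD_{n+1}}},\qquad \psi_n=\frac{\sum_{l=0}^nA^n_{n,l}\,p_kz^lw^{n-l}}{\sqrt{D_nD_{n+1}}}\qquad(n\ge0). \] These are orthonormal bases of $M_k\ominus zM_k$ and $M_k\ominus wM_k$ respectively. For $n\ge0$, $j\ge1$ define $\alpha_{n,j}^{(k)}=\langle w^j\phi_n,z^j\psi_n\rangle$. The implied constants in the $O$-terms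 may depend on $k$ and $j$. *)

(* Defs.v *)
From HB Require Import structures.
From mathcomp Require Import all_boot all_order all_algebra.
From mathcomp Require Import complex.
From mathcomp Require Import all_classical all_reals all_analysis.

Set Implicit Arguments.
Unset Strict Implicit.
Unset Printing Implicit Defensive.

Import Order.TTheory GRing.Theory Num.Theory.
Import numFieldNormedType.Exports.

Local Open Scope ring_scope.

(* The Hardy space over the bidisk, an element being given by its Taylor
   coefficients: [hardy_coef f a b] is the coefficient of z^a w^b. *)
Definition square_summable (R : realType) (f : nat -> nat -> R[i]) : Prop :=
  exists M : R[i], forall N : nat,
    \sum_(a < N) \sum_(b < N) `|f a b| ^+ 2 <= M.

Record hardy2 (R : realType) := Hardy2 {
  hardy_coef : nat -> nat -> R[i];
  hardy_coefP : square_summable hardy_coef }.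

(* Linear in the first argument. The double series converges absolutely, so
   taking square partial sums is harmless. *)
Definition hardy_dot (R : realType) (f g : hardy2 R) : R[i] :=
  limn ((fun N : nat =>
    \sum_(a < N) \sum_(b < N) hardy_coef f a b * (hardy_coef g a b)^*) : nat -> R[i]^o).

(* C[z, w] as polynomials in w whose coefficients are polynomials in z. *)
Notation bipoly R := {poly {poly R[i]}}.

Definition bicoef (R : realType) (q : bipoly R) (a b : nat) : R[i] := q`_b`_a.

Lemma bicoef_square_summable (R : realType) (q : bipoly R) :
  square_summable (bicoef q).
Proof.
pose m := \max_(b < size q) size (q`_b)%R.
exists (\sum_(a < m) \sum_(b < size q) `|bicoef q a b| ^+ 2) => N.
have h0 a b : (m <= a)%N || (size q <= b)%N -> `|bicoef q a b| ^+ 2 = 0.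
  case/orP => h; rewrite /bicoef; last first.
    by rewrite (nth_default _ h) coef0 normr0 expr0n.
  case: (ltnP b (size q)) => [hb|hb]; last first.
    by rewrite (nth_default _ hb) coef0 normr0 expr0n.
  rewrite (@nth_default _ _ q`_b) ?normr0 ?expr0n//.
  exact: leq_trans (leq_bigmax (Ordinal hb)) h.
have widen (F : nat -> R[i]) s t : (forall a, 0 <= F a) ->
    (forall a, (t <= a)%N -> F a = 0) -> \sum_(a < s) F a <= \sum_(a < t) F a.
  move=> F0 Ft; rewrite -!(big_mkord xpredT).
  have [st|ts] := leqP s t.
    by rewrite (big_cat_nat (n := s) _ st)//= lerDl sumr_ge0.
  have F1 : \sum_(t <= a < s) F a = 0.
    by rewrite big_nat big1// => a /andP[ta _]; exact: Ft.
  by rewrite (big_cat_nat (n := t) _ (ltnW ts))//= F1 addr0.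
apply: (@le_trans _ _ (\sum_(a < m) \sum_(b < N) `|bicoef q a b| ^+ 2)).
  apply: (widen (fun a => \sum_(b < N) `|bicoef q a b| ^+ 2)) => a.
    by apply: sumr_ge0 => b _; rewrite exprn_ge0.
  by move=> ha; rewrite big1// => b _; rewrite h0// ha.
apply: ler_sum => a _; apply: (widen (fun b => `|bicoef q a b| ^+ 2)) => b.
  by rewrite exprn_ge0.
by move=> hb; rewrite h0// hb orbT.
Qed.

Definition hardy_of_bipoly (R : realType) (q : bipoly R) : hardy2 R :=
  Hardy2 (bicoef_square_summable q).

Definition bipoly_dot (R : realType) (f g : bipoly R) : R[i] :=
  hardy_dot (hardy_of_bipoly f) (hardy_of_bipoly g).

Definition vz (R : realType) : bipoly R := 'X%:P.
Definition vw (R : realType) : bipoly R := 'X.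
Definition scal (R : realType) (c : R[i]) : bipoly R := c%:P%:P.

Definition pgen (R : realType) (k : nat) : bipoly R := (vz R - vw R) ^+ k.

Definition pmon (R : realType) (k n l : nat) : bipoly R :=
  pgen R k * vz R ^+ l * vw R ^+ (n - l).

Definition gram (R : realType) (k n : nat) : 'M[R[i]]_n.+1 :=
  \matrix_(i, j) bipoly_dot (pmon R k n i) (pmon R k n j).

Definition gram_det (R : realType) (k n : nat) : R[i] :=
  if n is m.+1 then \det (gram R k m) else 1.

(* [cofactor] is the signed cofactor. *)
Definition phi (R : realType) (k n : nat) : bipoly R :=
  scal (sqrtC (gram_det R k n * gram_det R k n.+1))^-1 *
  \sum_(l < n.+1) scal (cofactor (gram R k n) ord0 l) * pmon R k n l.

Definition psi (R : realType) (k n : nat) : bipoly R :=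
  scal (sqrtC (gram_det R k n * gram_det R k n.+1))^-1 *
  \sum_(l < n.+1) scal (cofactor (gram R k n) ord_max l) * pmon R k n l.

Definition alpha (R : realType) (k j n : nat) : R[i] :=
  bipoly_dot (vw R ^+ j * phi R k n) (vz R ^+ j * psi R k n).

(* Main.v *)
Require Import Defs.
From mathcomp Require Import all_boot all_order all_algebra.
From mathcomp Require Import complex.
From mathcomp Require Import all_classical all_reals all_analysis.
From mathcomp Require Import ring zify.
Import Order.TTheory GRing.Theory Num.Theory.
Import numFieldNormedType.Exports.
Local Open Scope classical_set_scope.
Local Open Scope ring_scope.
Set Implicit Arguments.
Unset Strict Implicit.
Unset Printing Implicit Defensive.

(* On the part of M_k that is homogeneous of degree n + k, the substitution
   x = z / w turns phi_n and psi_n into the reversed and the ordinary n-th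
   orthonormal polynomial of the unit circle for the weight |1 - x|^(2k).
   The reversed one is proportional to U = F(-n, k; -n-k; x).  By Euler's
   transformation the coefficients of (1-x)^(2k) U obey a two-term recurrence,
   which makes those of x^(k+1), ..., x^(k+n) vanish (this is the orthogonality)
   and determines the later ones.  By Cramer's rule the cofactors are then
   multiples of the coefficients of U, and alpha_{n,j} becomes
   -k/(n+k+1) sum_{s<j} u_s(n) t_{j-1-s}(n), where u_s and t_i tend to the
   binomial coefficients of (1-x)^(-k) and (1-x)^(k-1).  Expanding to first
   order in 1/(n+k), both the sum and its correction are evaluated by
   Chu-Vandermonde. *)

(** * The hypergeometric differential operator and Euler's transformation *)

Section HypergeometricOperator.
Variable F : comNzRingType.
Implicit Types (a b c : F) (p : {poly F}).

(** Gauss's operator, which annihilates F(a, b; c; x). *)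
Definition hyp_op a b c p : {poly F} :=
  'X * (1 - 'X) * p^`()^`() + (c%:P - (a + b + 1)%:P * 'X) * p^`() - (a * b)%:P * p.

Lemma coef_hyp_op a b c p l : (hyp_op a b c p)`_l =
  l.+1%:R * (l%:R + c) * p`_l.+1 - (l%:R + a) * (l%:R + b) * p`_l.
Proof.
have -> : hyp_op a b c p = 'X * p^`()^`() - 'X * ('X * p^`()^`()) + c%:P * p^`() -
   (a + b + 1)%:P * ('X * p^`()) - (a * b)%:P * p by rewrite /hyp_op; ring.
have cd q i : (q : {poly F})^`()`_i = i.+1%:R * q`_i.+1 by rewrite coef_deriv mulr_natl.
rewrite !(coefD, coefN, coefCM, coefXM, cd).
case: l => [|[|l]] /=; rewrite ?cd.
- by move: p`_0 p`_1 => x y; ring.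
- by move: p`_1 p`_2 => x y; ring.
by move: p`_l.+2 p`_l.+3 => x y; rewrite -!natr1; ring.
Qed.

(* Euler's transformation [(1-x)^(a+b-c) F(a,b;c;x) = F(c-a,c-b;c;x)], at the
   level of the differential operators. *)
Lemma hyp_op_euler a b c e p : a + b = c + e%:R ->
  hyp_op (c - a) (c - b) c ((1 - 'X) ^+ e * p) = (1 - 'X) ^+ e * hyp_op a b c p.
Proof.
move=> abc; have -> : b = c + e%:R - a by rewrite -abc; ring.
(* Two derivatives lower the exponent by up to two, so exponents 0 and 1 are separate; otherwise
   [(1 - 'X) ^+ e] factors out and a ring identity remains. *)
rewrite /hyp_op; case: e {abc} => [|[|e]].
- by rewrite expr0 !mul1r mulr0n; ring.
- by rewrite expr1 !poly.derivE mulr1n; ring.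
have dE m : ((1 - 'X : {poly F}) ^+ m.+1)^`() = - (m.+1%:R * (1 - 'X) ^+ m).
  by rewrite deriv_exp !poly.derivE sub0r mulN1r mulNrn mulr_natl.
have d0 m : (m%:R : {poly F})^`() = 0 by rewrite derivMn poly.derivE mul0rn.
rewrite derivM dE derivD derivM derivM derivN derivM d0 !dE !exprS -!natr1.
by move: (_ ^+ e) => W; ring.
Qed.

End HypergeometricOperator.

(** * Coefficient pairing on the circle and its Toeplitz matrix *)

Section CirclePairing.
Variables (F : comNzRingType) (k : nat).

Lemma coef_signM m (p : {poly F}) i : ((-1) ^+ m * p)`_i = (-1) ^+ m * p`_i.
Proof. by rewrite -polyC1 -polyCN -polyC_exp coefCM. Qed.

Lemma coef_expr_1subX m i : ((1 - 'X : {poly F}) ^+ m)`_i = (-1) ^+ i *+ 'C(m, i).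
Proof.
elim: m i => [|m IHm] i; first by rewrite expr0 coef1; case: i.
rewrite exprS mulrBl mul1r coefB coefXM !IHm; case: i => [|i] /=.
  by rewrite !bin0 subr0.
by rewrite binS mulrnDr exprS mulN1r [X in _ = _ + X]mulNrn.
Qed.

Lemma exprX_sub1 m : ('X - 1 : {poly F}) ^+ m = (-1) ^+ m * (1 - 'X) ^+ m.
Proof. by rewrite -exprMn mulN1r opprB. Qed.

Lemma coef_expr_Xsub1 m i :
  (('X - 1 : {poly F}) ^+ m)`_i = (-1) ^+ m * ((-1) ^+ i *+ 'C(m, i)).
Proof.
by rewrite exprX_sub1 coef_signM coef_expr_1subX.
Qed.

Definition coef_dot d (p q : {poly F}) : F := \sum_(a < d) p`_a * q`_a.

Lemma coef_dotC d p q : coef_dot d p q = coef_dot d q p.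
Proof. by apply: eq_bigr => a _; rewrite mulrC. Qed.

Lemma coef_dot_suml d n (c : 'I_n -> F) (p : 'I_n -> {poly F}) q :
  coef_dot d (\sum_(i < n) c i *: p i) q = \sum_(i < n) c i * coef_dot d (p i) q.
Proof.
rewrite /coef_dot; under eq_bigr do rewrite coef_sum big_distrl /=.
rewrite exchange_big; apply: eq_bigr => i _; rewrite big_distrr /=.
by apply: eq_bigr => a _; rewrite coefZ mulrA.
Qed.

(* On the unit circle [x^-1 = conj x], so pairing with [(x-1)^k x^m] amounts to
   multiplying by [(1-x)^k] and reading off the coefficient of [x^(k+m)]. *)
Lemma coef_dot_Xsub1 d m (p : {poly F}) : (k + m < d)%N ->
  coef_dot d (('X - 1) ^+ k * p) (('X - 1) ^+ k * 'X^m) =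
  (-1) ^+ k * ((1 - 'X) ^+ k.*2 * p)`_(k + m).
Proof.
move=> kmd; set P := ('X - 1) ^+ k * p.
have -> : (1 - 'X) ^+ k.*2 * p = (-1) ^+ k * ((1 - 'X) ^+ k * P).
  rewrite /P exprX_sub1 -addnn exprD -[LHS]mul1r -[X in X * _ = _](sqrr_sign _ k).
  ring.
rewrite coef_signM mulrA -expr2 sqrr_sign mul1r [_ * P]mulrC coefM.
pose f a := P`_a * ((1 - 'X : {poly F}) ^+ k)`_(k + m - a).
transitivity (\sum_(a < (k + m).+1) f a); last by [].
rewrite (big_ord_widen _ f kmd) [RHS]big_mkcond /=; apply: eq_bigr => a _.
rewrite /f coefMXn coef_expr_Xsub1 coef_expr_1subX ltnS.
(* Only m <= a <= k + m contributes; there the two sides agree by the symmetry of the binomial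
   coefficients. *)
have [am|ma] := ltnP a m.
  by rewrite bin_small ?mulr0n ?mulr0 ?if_same//; lia.
have [ak|ka] := leqP a (k + m); last by rewrite bin_small ?mulr0n ?mulr0//; lia.
have ck : (a - m <= k)%N by lia.
have -> : (k + m - a = k - (a - m))%N by lia.
rewrite bin_sub// mulrnAr -exprD -signr_odd -[in RHS]signr_odd oddD (oddB ck).
by [].
Qed.

(** The pairing of [('X - 1) ^+ k * 'X^i] with [('X - 1) ^+ k * 'X^j], written as one coefficient so
    that no truncation bound [d] appears. *)
Definition toeplitz_entry (i j : nat) : F :=
  (-1) ^+ k * ((1 - 'X) ^+ k.*2 * 'X^i : {poly F})`_(k + j).

Lemma coef_dot_Xsub1X d i j : (k + j < d)%N ->
  coef_dot d (('X - 1) ^+ k * 'X^i) (('X - 1) ^+ k * 'X^j) = toeplitz_entry i j.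
Proof. exact: coef_dot_Xsub1. Qed.

Lemma toeplitz_entryC i j : toeplitz_entry i j = toeplitz_entry j i.
Proof.
rewrite -(@coef_dot_Xsub1X (k + maxn i j).+1) ?ltnS ?leq_add2l ?leq_maxr//.
by rewrite coef_dotC coef_dot_Xsub1X// ltnS leq_add2l leq_maxl.
Qed.

Lemma toeplitz_entryS i j : toeplitz_entry i.+1 j.+1 = toeplitz_entry i j.
Proof. by rewrite /toeplitz_entry !coefMXn addnS ltnS subSS. Qed.

(** A symmetric Toeplitz matrix is unchanged when both indices are reversed. This transfers the
    solution for the first row of cofactors to the last row. *)
Lemma toeplitz_entry_rev n i j : (i <= n)%N -> (j <= n)%N ->
  toeplitz_entry (n - i) (n - j) = toeplitz_entry i j.
Proof.
have shift d a b : toeplitz_entry (a + d) (b + d) = toeplitz_entry a b.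
  by elim: d => [|d IHd]; rewrite ?addn0// !addnS toeplitz_entryS.
move=> ni nj; rewrite -(shift (i + j)%N (n - i)%N (n - j)%N) toeplitz_entryC.
have -> : (n - i + (i + j) = j + n)%N by lia.
have -> : (n - j + (i + j) = i + n)%N by lia.
by rewrite shift.
Qed.

Definition toeplitz n : 'M[F]_n.+1 := \matrix_(i, j) toeplitz_entry i j.

Definition toeplitz_det n : F := if n is m.+1 then \det (toeplitz m) else 1.

(** Cramer's rule: multiply the linear system by the adjugate, whose column r holds the cofactors of
    row r. *)
Lemma cofactor_of_solution n (A : 'M[F]_n.+1) (r : 'I_n.+1) (v : 'cV[F]_n.+1) c l :
  A *m v = c *: delta_mx r 0 -> c * cofactor A r l = \det A * v l 0.
Proof.
move=> Av; have := mul_adj_mx A => /(congr1 (mulmx^~ v)) /=.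
rewrite -mulmxA Av -scalemxAr -colE mul_scalar_mx => /colP/(_ l).
by rewrite !mxE => ->.
Qed.

End CirclePairing.

(** * The hypergeometric polynomial U and the coefficients of its weighted product *)

Section SzegoPolynomial.
Variables (F : numFieldType) (k : nat).
Hypothesis k_gt0 : (0 < k)%N.

(* Coefficients of the hypergeometric polynomial F(-n, k; -n-k; x). *)
Definition szego_coef (n l : nat) : F :=
  \prod_(i < l) (((k + i) * (n - i))%:R / (i.+1 * (n + k - i))%:R).

Definition szego n : {poly F} := \poly_(l < n.+1) szego_coef n l.

Lemma szego_coef0 n : szego_coef n 0 = 1.
Proof. by rewrite /szego_coef big_ord0. Qed.

Lemma szego_coef_ge0 n l : 0 <= szego_coef n l.
Proof. by apply: prodr_ge0 => i _; rewrite divr_ge0 ?ler0n. Qed.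

Lemma szego_coef_eq0 n l : (n < l)%N -> szego_coef n l = 0.
Proof.
by move=> nl; rewrite /szego_coef (bigD1 (Ordinal nl))//= subnn muln0 !mul0r.
Qed.

Lemma coef_szego n l : (szego n)`_l = szego_coef n l.
Proof. by rewrite coef_poly; case: ltnP => // /szego_coef_eq0 ->. Qed.

(** The hypergeometric equation read on coefficients. Subtraction is taken in [F], so that every l
    is covered; past the degree both sides vanish. *)
Lemma szego_coefS n l : l.+1%:R * ((n + k)%:R - l%:R) * szego_coef n l.+1 =
  (k + l)%:R * (n%:R - l%:R) * szego_coef n l.
Proof.
have [ln|nl] := leqP l n; last by rewrite !szego_coef_eq0 ?mulr0// ltnW.
rewrite /szego_coef big_ord_recr /= -!natrB//; last exact: leq_trans (leq_addr _ _).
rewrite !natrM; move: (\prod_(i < l) _) => P.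
have h1 : (l.+1%:R : F) != 0 by rewrite pnatr_eq0.
have h2 : ((n + k - l)%:R : F) != 0 
  by rewrite pnatr_eq0 subn_eq0 -ltnNge (leq_ltn_trans ln)// -[ltnLHS]addn0 ltn_add2l.
by rewrite mulrCA [X in P * X]mulrC divfK ?mulf_neq0// mulrC.
Qed.

Lemma hyp_op_szego n : hyp_op (- n%:R) k%:R (- (n + k)%:R) (szego n) = 0.
Proof.
apply/polyP => l; rewrite coef_hyp_op !coef_szego coef0.
apply/eqP; rewrite -oppr_eq0 opprB; apply/eqP.
transitivity (l.+1%:R * ((n + k)%:R - l%:R) * szego_coef n l.+1 -
  (k + l)%:R * (n%:R - l%:R) * szego_coef n l); last by rewrite szego_coefS subrr.
rewrite [(k + l)%:R]natrD; ring.
Qed.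

(* Up to the shift by [k] and the sign [(-1)^k], the Fourier coefficients of
   [|1 - x|^(2k) szego n] on the unit circle. *)
Definition szego_weight n : {poly F} := (1 - 'X) ^+ k.*2 * szego n.

(** Euler's transformation with a = -n, b = k, c = -n-k and e = 2k: the product solves the equation
    with parameters -k, -n-2k; -n-k. *)
Lemma szego_weight_rec n m :
  m.+1%:R * (m%:R - (n + k)%:R) * (szego_weight n)`_m.+1 =
  (m%:R - k%:R) * (m%:R - (n + k.*2)%:R) * (szego_weight n)`_m.
Proof.
have /(hyp_op_euler (szego n)) : - n%:R + k%:R = - (n + k)%:R + k.*2%:R :> F.
  by rewrite -addnn !natrD; ring.
rewrite hyp_op_szego mulr0 => /(congr1 (fun p : {poly F} => p`_m)).
rewrite coef_hyp_op coef0 => /eqP; rewrite subr_eq0 -/(szego_weight n) => /eqP.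
rewrite -addnn !natrD => e.
transitivity (m.+1%:R * (m%:R + - (n%:R + k%:R)) * (szego_weight n)`_m.+1) => //.
by rewrite e; ring.
Qed.

(** The right-hand factor of the recurrence vanishes at index k, and the zero propagates until the
    left-hand factor vanishes at index n + k. *)
Lemma szego_weight_gap n m : (0 < m <= n)%N -> (szego_weight n)`_(k + m) = 0.
Proof.
elim: m => // m IHm /= mn.
have z : ((k + m)%:R - k%:R) * (szego_weight n)`_(k + m) = 0.
  case: m IHm mn => [|m] IHm mn; first by rewrite addn0 subrr mul0r.
  by rewrite IHm ?mulr0//= ltnW.
have := szego_weight_rec n (k + m); rewrite [RHS]mulrAC z mul0r addnS => /eqP.
rewrite !mulf_eq0 pnatr_eq0 /= subr_eq0 eqr_nat [X in (_ == X)%N]addnC eqn_add2l.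
by rewrite ltn_eqF//= => /eqP.
Qed.

Lemma szego_weight0 n : (szego_weight n)`_0 = 1.
Proof.
rewrite coef0M coef_szego szego_coef0 mulr1 -horner_coef0 horner_exp.
by rewrite !hornerE subr0 expr1n.
Qed.

Lemma szego_weight_low n m : (m <= k)%N ->
  (szego_weight n)`_m = (-1) ^+ m * \prod_(i < m)
    (((k - i) * (n + k.*2 - i))%:R / (i.+1 * (n + k - i))%:R).
Proof.
elim: m => [|m IHm] mk; first by rewrite big_ord0 szego_weight0 expr0 mulr1.
have e : m.+1%:R * (n + k - m)%:R * (szego_weight n)`_m.+1 =
    - ((k - m)%:R * (n + k.*2 - m)%:R * (szego_weight n)`_m).
  rewrite !natrB; [|lia..].
  by rewrite -[(n + k)%:R - _]opprB mulrN mulNr szego_weight_rec; ring.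
have h1 : (m.+1%:R : F) != 0 by rewrite pnatr_eq0.
have h2 : ((n + k - m)%:R : F) != 0.
  by rewrite pnatr_eq0 subn_eq0 -ltnNge (leq_trans mk) ?leq_addl.
apply: (mulfI (mulf_neq0 h1 h2)); rewrite {}e IHm ?(ltnW mk)// big_ord_recr /=.
rewrite !natrM exprS; move: (\prod_(i < m) _) ((-1) ^+ m) h1 h2 => P s.
by move: (m.+1%:R : F) ((n + k - m)%:R : F) => x y h1 h2; field; rewrite h1 h2.
Qed.

Lemma prod_natr_rev m n :
  \prod_(i < n) (m + n - i)%:R = \prod_(i < n) (m + i.+1)%:R :> F.
Proof.
rewrite (reindex_inj rev_ord_inj); apply: eq_bigr => i _ /=; congr _%:R.
by have := ltn_ord i; lia.
Qed.

Lemma prod_natr_neq0 m n : \prod_(i < n) (m + i.+1)%:R != 0 :> F.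
Proof. by apply/prodf_neq0 => i _; rewrite pnatr_eq0 addnS. Qed.

Lemma prod_natrSl m n : \prod_(i < n.+1) (m + i.+1)%:R =
  (m + 1)%:R * \prod_(i < n) (m + 1 + i.+1)%:R :> F.
Proof.
rewrite big_ord_recl; congr (_ * _).
by apply: eq_bigr => i _; rewrite addn1 addSnnS.
Qed.

Lemma prod_natrSr m n : \prod_(i < n.+1) (m + i.+1)%:R =
  \prod_(i < n) (m + i.+1)%:R * (m + n.+1)%:R :> F.
Proof. by rewrite big_ord_recr. Qed.

Lemma szego_coef_last n : szego_coef n n = k%:R / (n + k)%:R.
Proof.
rewrite /szego_coef.
transitivity ((\prod_(i < n) (k + i)%:R * \prod_(i < n) (0 + n - i)%:R) /
    (\prod_(i < n) (0 + i.+1)%:R * \prod_(i < n) (k + n - i)%:R) : F).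
  rewrite -!big_split -prodf_div; apply: eq_bigr => i _ /=.
  by rewrite !natrM !add0n [(k + n)%N]addnC.
(* The factors n - i cancel against the factorial; the remaining product of (k + i) / (k + i + 1)
   telescopes. *)
rewrite !prod_natr_rev [X in X / _]mulrC -mulf_div divff ?prod_natr_neq0// mul1r.
elim: n => [|n IHn]; first by rewrite !big_ord0 !divff ?oner_neq0// pnatr_eq0 -lt0n.
rewrite !big_ord_recr /= -mulf_div IHn [(k + n)%N]addnC mulrA divfK.
  by rewrite [(k + n.+1)%N]addnC.
by rewrite pnatr_eq0 -lt0n addn_gt0 k_gt0 orbT.
Qed.

(** This turns out to be the ratio of consecutive Toeplitz determinants. *)
Definition szego_norm n : F := \prod_(i < k) ((n + k + i.+1)%:R / (n + i.+1)%:R).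

Lemma szego_norm_gt0 n : 0 < szego_norm n.
Proof. by apply: prodr_gt0 => i _; rewrite divr_gt0 ?ltr0n// addnS. Qed.

Lemma szego_weight_mid n : (szego_weight n)`_k = (-1) ^+ k * szego_norm n.
Proof.
rewrite szego_weight_low//; congr (_ * _).
transitivity ((\prod_(i < k) (0 + k - i)%:R * \prod_(i < k) ((n + k) + k - i)%:R) /
    (\prod_(i < k) (0 + i.+1)%:R * \prod_(i < k) (n + k - i)%:R) : F).
  rewrite -!big_split -prodf_div; apply: eq_bigr => i _ /=.
  by rewrite !natrM !add0n -addnA addnn.
by rewrite !prod_natr_rev -mulf_div divff ?prod_natr_neq0// mul1r -prodf_div.
Qed.

(** The recurrence degenerates at index n + k, so the coefficients above the gap need a separate
    normalisation. The leading coefficient provides it, since (1-x)^(2k) is monic. *)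
Lemma szego_weight_last n : (szego_weight n)`_(n + k.*2) = k%:R / (n + k)%:R.
Proof.
have -> : szego_weight n = ('X - 1%:P) ^+ k.*2 * szego n.
  by rewrite /szego_weight -opprB -mul2n exprM sqrrN -exprM.
have u0 : szego_coef n n != 0.
  by rewrite szego_coef_last mulf_neq0 ?invr_eq0 ?pnatr_eq0 -?lt0n// addn_gt0 k_gt0 orbT.
have su : size (szego n) = n.+1 by rewrite size_poly_eq.
have mon : ('X - 1%:P : {poly F}) ^+ k.*2 \is monic by rewrite monic_exp ?monicXsubC.
have := lead_coef_monicM (szego n) mon.
rewrite !lead_coefE size_monicM ?su//; last by rewrite -size_poly_eq0 su.
by rewrite size_exp_XsubC /= addnC coef_szego szego_coef_last.
Qed.

(** The coefficient of x^i in F(n+1, 1-k; n+k+2; x), obtained by iterating the recurrence beyond the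
    gap. *)
Definition szego_tail n i : F := \prod_(r < i)
  ((n + r.+1)%:R * (r.+1%:R - k%:R) / ((n + k + r.+2)%:R * r.+1%:R)).

Lemma szego_weight_high n i :
  (szego_weight n)`_(n + k + i.+1) = (szego_weight n)`_(n + k + 1) * szego_tail n i.
Proof.
elim: i => [|i IHi]; first by rewrite /szego_tail big_ord0 mulr1.
rewrite /szego_tail big_ord_recr -/(szego_tail n i) mulrA -IHi.
have := szego_weight_rec n (n + k + i.+1); rewrite -addnS => e.
have h1 : (i.+1%:R : F) != 0 by rewrite pnatr_eq0.
have h2 : ((n + k + i.+2)%:R : F) != 0 by rewrite pnatr_eq0 addnS.
apply: (mulfI (mulf_neq0 h2 h1)).
transitivity ((n + k + i.+2)%:R * ((n + k + i.+1)%:R - (n + k)%:R) * 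
  (szego_weight n)`_(n + k + i.+2)).
  by rewrite [(n + k + i.+1)%:R]natrD; ring.
rewrite e -addnn; move: (szego_weight n)`_(n + k + i.+1) => Q.
transitivity ((n + i.+1)%:R * (i.+1%:R - k%:R) * Q).
  by rewrite !(natrD _ _ i.+1) !natrD; ring.
by move: h1 h2; move: (i.+1%:R : F) ((n + k + i.+2)%:R : F) => x y h1 h2; field; rewrite h1 h2.
Qed.

(** The leading coefficient is the first coefficient after the gap times [szego_tail n k.-1];
    solving for the former and comparing with the middle coefficient leaves a single quotient. *)
Lemma szego_weight_ratio n :
  (szego_weight n)`_(n + k + 1) = - (k%:R / (n + k + 1)%:R) * (szego_weight n)`_k.
Proof.
have hl := szego_weight_last n.
have e0 : (n + k.*2 = n + k + k.-1.+1)%N by rewrite prednK// -addnn addnA.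
move: hl; rewrite e0 szego_weight_high szego_weight_mid.
have -> : szego_tail n k.-1 = (-1) ^+ k.-1 *
    (\prod_(r < k.-1) (n + r.+1)%:R / \prod_(r < k.-1) (n + k + 1 + r.+1)%:R).
  rewrite /szego_tail.
  (* Each factor r + 1 - k is minus k - 1 - r; in reversed order these cancel the factorial and
     leave only signs. *)
  transitivity (\prod_(r < k.-1) ((-1) * (n + r.+1)%:R * (0 + k.-1 - r)%:R / ((n + k + 1 + r.+1)%:R * (0 + r.+1)%:R)) : F).
    apply: eq_bigr => r _; rewrite addn1 addSnnS !add0n; congr (_ / _).
    rewrite -mulrA [RHS]mulrCA mulN1r; congr (_ * _).
    rewrite -opprB -natrB; last by have := ltn_ord r; lia.
    by congr (- _%:R); lia.
  rewrite prodf_div !big_split /= prod_natr_rev -[in LHS]mulf_div divff ?prod_natr_neq0//.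
  by rewrite mulr1 prodr_const card_ord mulrA.
rewrite /szego_norm prodf_div.
have -> : \prod_(i < k) (n + k + i.+1)%:R =
    (n + k + 1)%:R * \prod_(r < k.-1) (n + k + 1 + r.+1)%:R :> F.
  by rewrite -prod_natrSl prednK.
have -> : \prod_(i < k) (n + i.+1)%:R =
    (\prod_(r < k.-1) (n + r.+1)%:R) * (n + k)%:R :> F.
  by have := prod_natrSr n k.-1; rewrite prednK.
have p1 := prod_natr_neq0 (n + k + 1) k.-1; have p2 := prod_natr_neq0 n k.-1.
have p3 : ((n + k)%:R : F) != 0 by rewrite pnatr_eq0 -lt0n addn_gt0 k_gt0 orbT.
have p4 : ((n + k + 1)%:R : F) != 0 by rewrite pnatr_eq0 addn1.
have s1 : (-1) ^+ k.-1 * (-1) ^+ k.-1 = 1 :> F by rewrite -expr2 sqrr_sign.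
have -> : (-1) ^+ k = - (-1) ^+ k.-1 :> F by rewrite -{1}(prednK k_gt0) exprS mulN1r.
move: ((-1) ^+ k.-1) s1 p1 p2 p3 p4 => s s1.
move: (\prod_(r < k.-1) _) (\prod_(r < k.-1) _) (n + k)%:R (n + k + 1)%:R.
move=> P1 P2 x y p1 p2 p3 p4; move: (_`__) => q e.
have -> : q = q * (s * (P1 / P2)) * (s * (P2 / P1)).
  by transitivity (q * (s * s)); [rewrite s1 mulr1 | field; rewrite p1 p2].
by rewrite e; field; rewrite p2 p3 p4.
Qed.

(** * Cofactors and determinants of the Toeplitz matrix, and the resulting finite sum for alpha *)

Local Notation toeplitz_entry := (toeplitz_entry F k).
Local Notation toeplitz := (toeplitz F k).
Local Notation toeplitz_det := (toeplitz_det F k).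

(** Row i of the product is, up to sign, the coefficient of index k + i of the weighted polynomial:
    the middle one for i = 0, one in the gap otherwise. *)
Lemma sum_toeplitz_szego n i : (i <= n)%N ->
  \sum_(l < n.+1) toeplitz_entry i l * szego_coef n l = szego_norm n *+ (i == 0%N).
Proof.
move=> ni; transitivity ((-1) ^+ k * (szego_weight n)`_(k + i)).
  rewrite -(coef_dot_Xsub1 _ (ltnSn _)) /szego poly_def big_distrr /=.
  under [X in coef_dot _ X _]eq_bigr do rewrite -scalerAr.
  rewrite coef_dot_suml; apply: eq_bigr => l _.
  by rewrite coef_dot_Xsub1X// mulrC toeplitz_entryC.
case: i ni => [|i] ni; last by rewrite szego_weight_gap ?mulr0.
by rewrite addn0 szego_weight_mid mulrA -expr2 sqrr_sign mul1r.
Qed.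

Lemma cofactor_toeplitz_first n l :
  szego_norm n * cofactor (toeplitz n) ord0 l = \det (toeplitz n) * szego_coef n l.
Proof.
rewrite (@cofactor_of_solution _ _ _ _ (\col_i szego_coef n i)) ?mxE//.
apply/colP => i; rewrite !mxE andbT -[i == _]/(i == 0 :> nat) mulr_natr.
rewrite -sum_toeplitz_szego ?leq_ord//; apply: eq_bigr => j _.
by rewrite !mxE.
Qed.

Lemma cofactor_toeplitz_last n l :
  szego_norm n * cofactor (toeplitz n) ord_max l =
  \det (toeplitz n) * szego_coef n (n - l).
Proof.
rewrite (@cofactor_of_solution _ _ _ _ (\col_i szego_coef n (n - i))) ?mxE//.
apply/colP => i; rewrite !mxE andbT mulr_natr.
have -> : (i == ord_max) = (n - i == 0)%N.
  by rewrite subn_eq0 -val_eqE /= eqn_leq -ltnS ltn_ord.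
rewrite -sum_toeplitz_szego ?leq_subr// (reindex_inj rev_ord_inj).
apply: eq_bigr => j _; rewrite !mxE /= subSS subKn ?leq_ord//.
by rewrite -[in LHS](@toeplitz_entry_rev _ _ n) ?leq_subr ?leq_ord// subKn ?leq_ord.
Qed.

Lemma cofactor_toeplitz00 n : cofactor (toeplitz n) ord0 ord0 = toeplitz_det n.
Proof.
rewrite /cofactor expr0 mul1r; case: n => [|n]; first by rewrite det_mx00.
by congr (\det _); apply/matrixP => i j; rewrite !mxE /= toeplitz_entryS.
Qed.

(** The corner cofactor is the smaller determinant, and U has constant term 1. *)
Lemma toeplitz_detS n : toeplitz_det n.+1 = szego_norm n * toeplitz_det n.
Proof.
by rewrite -(cofactor_toeplitz00 n) cofactor_toeplitz_first szego_coef0 mulr1.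
Qed.

Lemma toeplitz_det_gt0 n : 0 < toeplitz_det n.
Proof.
by elim: n => [|n IHn]; rewrite ?ltr01// toeplitz_detS mulr_gt0 ?szego_norm_gt0.
Qed.

Lemma cofactor_toeplitz_firstE n l :
  cofactor (toeplitz n) ord0 l = toeplitz_det n * szego_coef n l.
Proof.
apply: (mulfI (lt0r_neq0 (szego_norm_gt0 n))).
by rewrite cofactor_toeplitz_first mulrA -toeplitz_detS.
Qed.

Lemma cofactor_toeplitz_lastE n l :
  cofactor (toeplitz n) ord_max l = toeplitz_det n * szego_coef n (n - l).
Proof.
apply: (mulfI (lt0r_neq0 (szego_norm_gt0 n))).
by rewrite cofactor_toeplitz_last mulrA -toeplitz_detS.
Qed.

(* [<phi_n, x^j psi_n>], with both polynomials in the circle variable. *)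
Definition szego_alpha (j n : nat) : F := (szego_norm n)^-1 *
  \sum_(m < n.+1) szego_coef n (n - m) *
    ((-1) ^+ k * (szego_weight n)`_(k + (j + m))).

(** After the reversal s = n - m, the terms with s > j fall into the gap; the others lie above it
    and are given by [szego_tail]. *)
Lemma szego_alphaE j n : szego_alpha j.+1 n = - (k%:R / (n + k + 1)%:R) *
  \sum_(s < j.+1) szego_coef n s * szego_tail n (j - s).
Proof.
rewrite /szego_alpha (reindex_inj rev_ord_inj) /=.
pose f s := szego_coef n s * ((-1) ^+ k * (szego_weight n)`_(k + (j.+1 + (n - s)))).
transitivity ((szego_norm n)^-1 * \sum_(s < n.+1) f s).
  by congr (_ * _); apply: eq_bigr => s _; rewrite subSS subKn ?leq_ord.
have f0 s : (n < s)%N || (j < s)%N -> f s = 0.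
  case: ltnP => /= [ns _|sn js]; first by rewrite /f szego_coef_eq0 ?mul0r.
  by rewrite /f szego_weight_gap ?mulr0 //; lia.
(* Whichever of n and j is larger, the extra terms are zero. *)
have -> : \sum_(s < n.+1) f s = \sum_(s < j.+1) f s.
  have widen m1 m2 : (m1 <= m2)%N -> (forall s, (m1 <= s)%N -> f s = 0) ->
      \sum_(s < m2) f s = \sum_(s < m1) f s.
    move=> m12 fm; rewrite (big_ord_widen _ f m12) [RHS]big_mkcond.
    by apply: eq_bigr => s _ /=; case: ltnP => // /fm.
  case: (leqP n j) => nj; [apply/esym|]; apply: widen => //.
  - by move=> s ns; apply: f0; rewrite ns.
  - by rewrite ltnW.
  - by move=> s ns; apply: f0; rewrite ns orbT.
rewrite !big_distrr /=; apply: eq_bigr => s _.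
have [sn|ns] := leqP s n; last by rewrite /f szego_coef_eq0// !(mul0r, mulr0).
rewrite /f; have -> : (k + (j.+1 + (n - s)) = n + k + (j - s).+1)%N.
  by have := ltn_ord s; lia.
rewrite szego_weight_high szego_weight_ratio szego_weight_mid.
have N0 := lt0r_neq0 (szego_norm_gt0 n).
have s1 : (-1) ^+ k * (-1) ^+ k = 1 :> F by rewrite -expr2 sqrr_sign.
transitivity (szego_coef n s * ((-1) ^+ k * (-1) ^+ k) * (- (k%:R / (n + k + 1)%:R)) *
  szego_tail n (j - s) * ((szego_norm n)^-1 * szego_norm n)); first by ring.
by rewrite s1 mulVf// !mulr1 mulrCA mulrA.
Qed.

Lemma szego_alphaS_real j n : szego_alpha j.+1 n \is Num.real.
Proof.
have natR m : (m%:R : F) \is Num.real by rewrite realn.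
rewrite szego_alphaE rpredM ?rpredN ?rpred_div ?natR// rpred_sum// => s _.
apply: rpredM; [exact/ger0_real/szego_coef_ge0 | apply: rpred_prod => r _].
by rewrite rpred_div ?rpredM ?rpredB ?natR.
Qed.

(** * First-order expansions in 1/(n+k) *)

Definition expands (f : nat -> F) (a b : F) : Prop :=
  exists2 c, 0 <= c & exists n0, forall n, (n0 <= n)%N ->
    `|f n - (a + b / (n + k)%:R)| <= c / (n + k)%:R ^+ 2.

Lemma invr_addk_gt0 n : 0 < (n + k)%:R^-1 :> F.
Proof. by rewrite invr_gt0 ltr0n addn_gt0 k_gt0 orbT. Qed.

Lemma invr_addk_le1 n : (n + k)%:R^-1 <= 1 :> F.
Proof. by rewrite invf_le1 ?ler1n ?ltr0n addn_gt0 k_gt0 orbT. Qed.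

Lemma expands_ext f g a b : f =1 g -> expands f a b -> expands g a b.
Proof.
by move=> fg [c c0 [n0 fc]]; exists c => //; exists n0 => n; rewrite -fg; exact: fc.
Qed.

Lemma expands_cst a : expands (fun=> a) a 0.
Proof.
by exists 0 => //; exists 0%N => n _; rewrite !mul0r addr0 subrr normr0.
Qed.

Lemma expandsD f g a b a' b' : expands f a b -> expands g a' b' ->
  expands (fun n => f n + g n) (a + a') (b + b').
Proof.
move=> [c c0 [n0 fc]] [c' c0' [n1 gc]].
exists (c + c'); [exact: addr_ge0 | exists (maxn n0 n1) => n].
rewrite geq_max => /andP[/fc {}fc /gc {}gc]; rewrite [leRHS]mulrDl.
apply: le_trans (lerD fc gc); apply: le_trans (ler_normD _ _).
by rewrite le_eqVlt; apply/orP; left; apply/eqP; congr `|_|; ring.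
Qed.

Lemma expandsM f g a b a' b' : expands f a b -> expands g a' b' ->
  expands (fun n => f n * g n) (a * a') (a * b' + b * a').
Proof.
move=> [c c0 [n0 fc]] [c' c0' [n1 gc]].
(* The three summands bound the three terms into which the error of the product is split below. *)
exists (c * (`|a'| + `|b'| + c') + (`|a| + `|b|) * c' + `|b * b'|).
  by rewrite !(addr_ge0, mulr_ge0).
exists (maxn n0 n1) => n; rewrite geq_max => /andP[/fc {}fc /gc {}gc]; move: fc gc.
rewrite -exprVn; have x0 := ltW (invr_addk_gt0 n); have x1 := invr_addk_le1 n.
move: (_^-1) x0 x1 => x x0 x1 fc gc.
have x20 : 0 <= x ^+ 2 by rewrite exprn_ge0.
have x21 : x ^+ 2 <= 1 by rewrite exprn_ile1.
have lin u v : `|u + v * x| <= `|u| + `|v| :> F.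
  apply: le_trans (ler_normD _ _) _; rewrite lerD2l normrM (ger0_norm x0).
  by rewrite ler_piMr.
have gbound : `|g n| <= `|a'| + `|b'| + c'.
  rewrite -[g n](subrK (a' + b' * x)) addrC; apply: le_trans (ler_normD _ _) _.
  by rewrite lerD// (le_trans gc)// ler_piMr.
have -> : f n * g n - (a * a' + (a * b' + b * a') * x) =
    (f n - (a + b * x)) * g n + (a + b * x) * (g n - (a' + b' * x)) + b * b' * x ^+ 2.
  by ring.
rewrite [leRHS]mulrDl; apply: le_trans (ler_normD _ _) _; apply: lerD; last first.
  by rewrite normrM (ger0_norm x20).
apply: le_trans (ler_normD _ _) _; rewrite [leRHS]mulrDl; apply: lerD; rewrite normrM.
  by rewrite mulrAC ler_pM.
by rewrite -mulrA ler_pM.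
Qed.

Lemma expands_sum m (f : 'I_m -> nat -> F) (a b : 'I_m -> F) :
  (forall i, expands (f i) (a i) (b i)) ->
  expands (fun n => \sum_(i < m) f i n) (\sum_(i < m) a i) (\sum_(i < m) b i).
Proof.
elim: m => [|m IHm] in f a b * => fab.
  by rewrite !big_ord0; apply: expands_ext (expands_cst 0) => n; rewrite big_ord0.
rewrite !big_ord_recr; apply: expands_ext (expandsD (IHm _ _ _ _) (fab ord_max)).
  by move=> n; rewrite big_ord_recr.
by move=> i; exact: fab.
Qed.

Lemma expands_ratio p q s :
  expands (fun n => (n + p - s)%:R / (n + q - s)%:R) 1 (p%:R - q%:R).
Proof.
(* The error is exactly (p-q)(k+s-q) / ((n+q-s)(n+k)), and (n+k)/(n+q-s) <= k+2 once n > 2s. *)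
exists (`|(p%:R - q%:R) * ((k + s)%:R - q%:R)| * (k + 2)%:R); first by rewrite mulr_ge0 ?ler0n.
exists (s.*2.+1) => n sn.
have y0 : ((n + q - s)%:R : F) != 0 by rewrite pnatr_eq0; lia.
have x0 : ((n + k)%:R : F) != 0 by rewrite pnatr_eq0; lia.
have -> : (n + p - s)%:R / (n + q - s)%:R - (1 + (p%:R - q%:R) / (n + k)%:R) =
    ((p%:R - q%:R) * ((k + s)%:R - q%:R)) * ((n + q - s)%:R^-1 / (n + k)%:R) :> F.
  have ep : (n + p - s)%:R = (n + q - s)%:R + (p%:R - q%:R) :> F.
    by rewrite !natrB ?natrD; [ring|lia|lia].
  have ek : (k + s)%:R - q%:R = (n + k)%:R - (n + q - s)%:R :> F.
    by rewrite natrB ?natrD; [ring|lia].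
  rewrite ep ek; move: y0 x0; move: (n + q - s)%:R (n + k)%:R => y x y0 x0.
  by field; rewrite y0 x0.
rewrite normrM -mulrA ler_wpM2l// ger0_norm; last by rewrite divr_ge0 ?invr_ge0.
rewrite expr2 invfM mulrA ler_wpM2r ?invr_ge0//.
rewrite ler_pdivlMr ?ltr0n; last by lia.
by rewrite mulrC ler_pdivrMr ?ltr0n -?natrM ?ler_nat; nia.
Qed.

(** The coefficient of x^m in (1-x)^(-c). *)
Definition rising_bin (c : F) m : F := \prod_(i < m) ((c + i%:R) / i.+1%:R).

Lemma rising_binS c m : m.+1%:R * rising_bin c m.+1 = (c + m%:R) * rising_bin c m.
Proof.
by rewrite /rising_bin big_ord_recr /= mulrCA mulrC [X in X * _]mulrCA divff ?pnatr_eq0// mulr1.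
Qed.

(** Each of the s factors (n-i)/(n+k-i) contributes -k to the first-order term. *)
Lemma expands_szego_coef s :
  expands (fun n => szego_coef n s) (rising_bin k%:R s) (- (k * s)%:R * rising_bin k%:R s).
Proof.
elim: s => [|s IHs].
  rewrite muln0 oppr0 mul0r /rising_bin big_ord0.
  by apply: expands_ext (expands_cst 1) => n; rewrite szego_coef0.
have /(expandsM IHs) := expandsM (expands_cst ((k + s)%:R / s.+1%:R)) (expands_ratio 0 k s).
set a := (X in expands _ X); set b := (X in expands _ _ X).
have -> : a = rising_bin k%:R s.+1.
  by rewrite /a mulr1 /rising_bin big_ord_recr natrD.
have -> : b = - (k * s.+1)%:R * rising_bin k%:R s.+1.
  rewrite /b /rising_bin big_ord_recr /= mulr1 addr0 sub0r mulnS.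
  by rewrite [(k + s)%:R]natrD [(k + k * s)%:R]natrD; ring.
apply: expands_ext => n; rewrite /szego_coef big_ord_recr /= !natrM addn0.
by rewrite -mulf_div.
Qed.

(** Each of the i factors (n+r+1)/(n+k+r+2) contributes -(k+1) to the first-order term. *)
Lemma expands_szego_tail i :
  expands (fun n => szego_tail n i) (rising_bin (1 - k%:R) i)
    (- (k.+1 * i)%:R * rising_bin (1 - k%:R) i).
Proof.
elim: i => [|i IHi].
  rewrite muln0 oppr0 mul0r /rising_bin big_ord0.
  by apply: expands_ext (expands_cst 1) => n; rewrite /szego_tail big_ord0.
have /(expandsM IHi) := expandsM (expands_cst ((i.+1%:R - k%:R) / i.+1%:R))
  (expands_ratio i.+1 (k + i.+2) 0).
set a := (X in expands _ X); set b := (X in expands _ _ X).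
have r : rising_bin (1 - k%:R) i.+1 =
    rising_bin (1 - k%:R) i * ((i.+1%:R - k%:R) / i.+1%:R).
  by rewrite /rising_bin big_ord_recr /= -[i.+1%:R - _]/((1 + i)%:R - _) natrD addrAC.
have -> : a = rising_bin (1 - k%:R) i.+1 by rewrite /a mulr1 r.
have -> : b = - (k.+1 * i.+1)%:R * rising_bin (1 - k%:R) i.+1.
  rewrite /b r mulr1 addr0 mulnS [(_ + _ * _)%:R]natrD.
  by rewrite -addSnnS [(k.+1 + i.+1)%:R]natrD; ring.
apply: expands_ext => n; rewrite /szego_tail big_ord_recr /= !subn0 addnA.
by rewrite [in RHS]mulrC mulf_div mulrC; congr (_ * _); congr (_ / _); rewrite mulrC.
Qed.

(* Chu-Vandermonde and its first moment: the coefficients of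
   [(1-x)^-k (1-x)^(k-1)] and of [x d/dx(1-x)^-k (1-x)^(k-1)]. *)
Lemma rising_bin_conv m :
  \sum_(s < m.+1) rising_bin k%:R s * rising_bin (1 - k%:R) (m - s) = 1 /\
  \sum_(s < m.+1) s%:R * (rising_bin k%:R s * rising_bin (1 - k%:R) (m - s)) = (k * m)%:R.
Proof.
set a := rising_bin _; set b := rising_bin _.
elim: m => [|m [f1 g1]].
  by rewrite !big_ord1 mul0r muln0 /a /b /rising_bin !big_ord0 mulr1.
(* Both identities are carried through one induction. The new moment follows from the two old ones
   by s a_s = (k+s-1) a_(s-1). *)
have g2 : \sum_(s < m.+2) s%:R * (a s * b (m.+1 - s)%N) = (k * m.+1)%:R.
  rewrite big_ord_recl mul0r add0r.
  transitivity (\sum_(s < m.+1) (k%:R + s%:R) * (a s * b (m - s)%N)).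
    apply: eq_bigr => s _; rewrite /= subSS mulrA.
    by rewrite [X in X * _]rising_binS mulrA.
  under eq_bigr do rewrite mulrDl.
  by rewrite big_split -big_distrr /= f1 g1 mulr1 mulnS natrD.
split=> //; apply: (mulfI (_ : m.+1%:R != 0)); first by rewrite pnatr_eq0.
rewrite mulr1 big_distrr.
(* Split m + 1 = s + (m + 1 - s): the first part is the moment just found, the second is lowered by
   the recurrence for [b]. *)
transitivity (\sum_(s < m.+2) s%:R * (a s * b (m.+1 - s)%N) +
   \sum_(s < m.+2) (m.+1 - s)%:R * (a s * b (m.+1 - s)%N)).
  rewrite -big_split; apply: eq_bigr => s _; rewrite /= -mulrDl -natrD subnKC//.
  exact: leq_ord.
rewrite g2 big_ord_recr /= subnn mul0r addr0.
transitivity ((k * m.+1)%:R +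
    \sum_(s < m.+1) ((1 - k%:R + m%:R) * (a s * b (m - s)%N) - s%:R * (a s * b (m - s)%N))).
  congr (_ + _); apply: eq_bigr => s _; rewrite subSn ?leq_ord//.
  by rewrite mulrCA rising_binS natrB ?leq_ord// -/b; ring.
rewrite big_split -big_distrr sumrN /= f1 g1 mulnS natrD -natr1; ring.
Qed.

(** With i = j - 1, the sum contributes ki - (k+1)i = -i at first order and the prefactor
    (n+k)/(n+k+1) contributes -1, in total -j. *)
Lemma expands_szego_alpha j : (0 < j)%N ->
  exists2 f, expands f 1 (- j%:R) &
    forall n, szego_alpha j n = - (k%:R / (n + k)%:R) * f n.
Proof.
case: j => // j _.
(* The subtractions of 0 match the shape of [expands_ratio]. *)
exists (fun n => (n + k - 0)%:R / (n + k.+1 - 0)%:R *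
   \sum_(s < j.+1) szego_coef n s * szego_tail n (j - s)); last first.
  move=> n; rewrite szego_alphaE !subn0 addn1 addnS.
  have x0 : ((n + k)%:R : F) != 0 by rewrite pnatr_eq0 -lt0n addn_gt0 k_gt0 orbT.
  have y0 : ((n + k).+1%:R : F) != 0 by rewrite pnatr_eq0.
  move: x0 y0; move: (n + k)%:R (n + k).+1%:R => x y x0 y0.
  by field; rewrite x0 y0.
have [f1 g1] := rising_bin_conv j.
have /(expandsM (expands_ratio k k.+1 0)) := expands_sum (fun s : 'I_j.+1 =>
  expandsM (expands_szego_coef s) (expands_szego_tail (j - s))).
rewrite f1 mulr1.
set b := (X in expands _ _ X); suff -> : b = - j.+1%:R by [].
rewrite /b -natr1.
transitivity (\sum_(s < j.+1) (s%:R * (rising_bin k%:R s * rising_bin (1 - k%:R) (j - s))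
  - k.+1%:R * j%:R * (rising_bin k%:R s * rising_bin (1 - k%:R) (j - s))) - 1 : F).
  rewrite mul1r mulr1 -natr1; congr (_ + _); last by ring.
  apply: eq_bigr => s _; rewrite !natrM natrB ?leq_ord// -natr1; ring.
rewrite big_split sumrN -big_distrr /= f1 g1 natrM -!natr1; ring.
Qed.

End SzegoPolynomial.

(** * Reduction from homogeneous polynomials on the bidisk to one variable *)

Section Bidisk.
Variable R : realType.
Implicit Types (p q : {poly R[i]}) (f g : bipoly R).

(* [f] is homogeneous of degree [d] and [f (z, w) = w^d p (z / w)]. *)
Definition dehomog (d : nat) p f : Prop :=
  (size p <= d.+1)%N /\
  forall a b, bicoef f a b = if (a + b == d)%N then p`_a else 0.

Lemma dehomog_mulz d p f : dehomog d p f -> dehomog d.+1 ('X * p) (vz R * f).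
Proof.
move=> [sp fE]; split.
  by rewrite mulrC (leq_trans (size_polyMleq _ _))// size_polyX addn2.
move=> a b; rewrite /bicoef /vz coefCM !coefXM.
by case: a => [|a] /=; rewrite ?if_same// -/(bicoef f a b) fE.
Qed.

Lemma dehomog_mulw d p f : dehomog d p f -> dehomog d.+1 p (vw R * f).
Proof.
move=> [sp fE]; split; first exact: leqW.
move=> a b; rewrite /bicoef /vw coefXM; case: b => [|b] /=.
  by rewrite coef0 addn0; case: eqP => // ->; rewrite nth_default.
by rewrite -/(bicoef f a b) fE addnS.
Qed.

Lemma dehomogD d p q f g :
  dehomog d p f -> dehomog d q g -> dehomog d (p + q) (f + g).
Proof.
move=> [sp fE] [sq gE]; split; first by rewrite (leq_trans (size_polyD _ _))// geq_max sp.
by move=> a b; rewrite /bicoef !coefD -!/(bicoef _ a b) fE gE; case: ifP; rewrite ?addr0.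
Qed.

Lemma dehomog_scal d c p f : dehomog d p f -> dehomog d (c *: p) (scal c * f).
Proof.
move=> [sp fE]; split; first exact: leq_trans (size_scale_leq _ _) sp.
move=> a b; rewrite /bicoef /scal !coefCM -/(bicoef f a b) fE coefZ.
by case: ifP; rewrite ?mulr0.
Qed.

Lemma dehomog0 d : dehomog d 0 0.
Proof. by split=> [|a b]; rewrite ?size_poly0// /bicoef !coef0 if_same. Qed.

Lemma dehomog_sum d n (p : 'I_n -> {poly R[i]}) (f : 'I_n -> bipoly R) :
  (forall i, dehomog d (p i) (f i)) -> dehomog d (\sum_i p i) (\sum_i f i).
Proof.
move=> pf; elim/big_rec2: _ => [|i q g _ qg]; first exact: dehomog0.
exact: dehomogD.
Qed.

Lemma dehomog_pmon k n l : (l <= n)%N ->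
  dehomog (k + n) (('X - 1) ^+ k * 'X^l) (pmon R k n l).
Proof.
move=> ln.
have hw m : dehomog m 1 (vw R ^+ m).
  elim: m => [|m IHm]; last by rewrite exprS; exact: dehomog_mulw.
  split=> [|a b]; rewrite ?size_poly1// expr0 /bicoef !coef1 addn_eq0.
  by case: b => [|b]; rewrite ?coef1 ?coef0 ?andbT ?andbF//; case: a.
have hz m d p f : dehomog d p f -> dehomog (m + d) ('X^m * p) (vz R ^+ m * f).
  move=> pf; elim: m => [|m IHm]; first by rewrite !mul1r.
  by rewrite !exprS -!mulrA; exact: dehomog_mulz.
have hp m d p f : dehomog d p f -> dehomog (m + d) (('X - 1) ^+ m * p) (pgen R m * f).
  move=> pf; elim: m => [|m IHm]; first by rewrite /pgen !mul1r.
  rewrite /pgen !exprS -!mulrA !mulrBl mul1r; apply: dehomogD; first exact: dehomog_mulz.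
  have -> : - (('X - 1) ^+ m * p) = -1 *: (('X - 1) ^+ m * p) by rewrite scaleN1r.
  have -> : - (vw R * (pgen R m * f)) = scal (-1) * (vw R * (pgen R m * f)).
    by rewrite /scal !polyCN !mulN1r.
  by apply/dehomog_scal/dehomog_mulw.
have := hp k _ _ _ (hz l _ _ _ (hw (n - l)%N)).
by rewrite subnKC// mulr1 /pmon mulrA.
Qed.

Lemma bipoly_dot_dehomog d p q f g : dehomog d p f -> dehomog d q g ->
  bipoly_dot f g = \sum_(a < d.+1) p`_a * (q`_a)^*.
Proof.
move=> [sp fE] [sq gE]; rewrite /bipoly_dot /hardy_dot.
apply: (@norm_lim_near_cst R[i] R[i]^o).
(* The square partial sums are constant once they contain the antidiagonal a + b = d, so the limit
   is that constant. *)
exists d.+1 => // N /= dN.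
rewrite (big_ord_widen N (fun a => p`_a * (q`_a)^*))// [RHS]big_mkcond /=.
apply: eq_bigr => a _; under eq_bigr do rewrite fE gE.
case: ltnP => ad; last first.
  rewrite big1// => b _; case: eqP => [e|_]; last by rewrite mul0r.
  by move: ad; rewrite -e ltnNge leq_addr.
have dN' : (d - a < N)%N by lia.
rewrite (bigD1 (Ordinal dN'))//= subnKC// eqxx big1 ?addr0// => b /eqP ba.
case: eqP => [e|_]; last by rewrite mul0r.
by case: ba; apply/val_inj => /=; rewrite -e addKn.
Qed.

Lemma bipoly_dot_real d p q f g : (forall a, q`_a \is Num.real) ->
  dehomog d p f -> dehomog d q g -> bipoly_dot f g = coef_dot d.+1 p q.
Proof.
move=> qr pf qg; rewrite (bipoly_dot_dehomog pf qg).
by apply: eq_bigr => a _; rewrite (CrealP (qr a)).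
Qed.

Lemma coef_Xsub1X_real k m a :
  ((('X - 1) ^+ k * 'X^m : {poly R[i]})`_a) \is Num.real.
Proof.
rewrite coefMXn coef_expr_Xsub1; case: ifP => _; first exact: rpred0.
by rewrite rpredM ?rpredMn ?rpredX ?rpredN ?rpred1.
Qed.

Lemma gram_toeplitz k n : gram R k n = toeplitz _ k n.
Proof.
apply/matrixP => i j; rewrite !mxE (bipoly_dot_real _ (dehomog_pmon _ (leq_ord i))
  (dehomog_pmon _ (leq_ord j))) ?coef_dot_Xsub1X ?ltnS ?leq_add2l ?leq_ord//.
exact: coef_Xsub1X_real.
Qed.

Lemma gram_det_toeplitz k n : gram_det R k n = toeplitz_det _ k n.
Proof. by case: n => //= n; rewrite gram_toeplitz. Qed.

Lemma alpha_szego k j n : (0 < k)%N -> alpha R k j n = szego_alpha _ k j n.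
Proof.
move=> k0; pose D m : R[i] := toeplitz_det _ k m.
have D0 m : 0 < D m by exact: toeplitz_det_gt0.
pose c : R[i] := (sqrtC (D n * D n.+1))^-1.
have c0 : 0 <= c by rewrite invr_ge0 sqrtC_ge0 ltW ?mulr_gt0.
(* The two normalisations and the two cofactor prefactors combine to D_n / D_(n+1). *)
have hc : c ^+ 2 * D n ^+ 2 = (szego_norm _ k n)^-1.
  rewrite /c exprVn sqrtCK {2}/D toeplitz_detS// -/(D n).
  have N0 := lt0r_neq0 (szego_norm_gt0 R[i] k n).
  by have := lt0r_neq0 (D0 n) => d0; field; rewrite N0 d0.
pose P := c *: \sum_(l < n.+1) (D n * szego_coef _ k n l) *: (('X - 1) ^+ k * 'X^l).
pose Q := c *: \sum_(l < n.+1) (D n * szego_coef _ k n (n - l)) *: (('X - 1) ^+ k * 'X^l).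
have hP : dehomog (k + n) P (phi R k n).
  rewrite /phi !gram_det_toeplitz gram_toeplitz; apply/dehomog_scal/dehomog_sum => l.
  by rewrite cofactor_toeplitz_firstE//; apply/dehomog_scal/dehomog_pmon/leq_ord.
have hQ : dehomog (k + n) Q (psi R k n).
  rewrite /psi !gram_det_toeplitz gram_toeplitz; apply/dehomog_scal/dehomog_sum => l.
  by rewrite cofactor_toeplitz_lastE//; apply/dehomog_scal/dehomog_pmon/leq_ord.
(* Under x = z/w, multiplication by w^j only raises the degree, while z^j becomes x^j. *)
have hPw : dehomog (j + (k + n)) P (vw R ^+ j * phi R k n).
  elim: j => [|i IHi]; first by rewrite mul1r.
  by rewrite exprS -mulrA; exact: dehomog_mulw.
have hQz : dehomog (j + (k + n)) ('X^j * Q) (vz R ^+ j * psi R k n).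
  elim: j {hPw} => [|i IHi]; first by rewrite !mul1r.
  by rewrite !exprS -!mulrA; exact: dehomog_mulz.
rewrite /alpha (bipoly_dot_real _ hPw hQz); last first.
  move=> a; rewrite coefXnM; case: ifP => _; first exact: rpred0.
  rewrite coefZ coef_sum; apply: rpredM; [exact: ger0_real | apply: rpred_sum => l _].
  rewrite coefZ; apply: rpredM; last exact: coef_Xsub1X_real.
  by rewrite rpredM// ger0_real ?szego_coef_ge0// ltW.
have -> : P = (c * D n) *: (('X - 1) ^+ k * szego _ k n).
  rewrite /P /szego poly_def big_distrr /= -scalerA; congr (_ *: _).
  by rewrite scaler_sumr; apply: eq_bigr => l _; rewrite -scalerAr scalerA.
have -> : 'X^j * Q = \sum_(l < n.+1) (c * D n * szego_coef _ k n (n - l)) *: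
    (('X - 1) ^+ k * 'X^(j + l)).
  rewrite /Q -scalerAr big_distrr scaler_sumr; apply: eq_bigr => l _ /=.
  by rewrite -scalerAr scalerA ['X^j * _]mulrCA -exprD mulrA.
rewrite coef_dotC coef_dot_suml /szego_alpha -hc big_distrr /=.
apply: eq_bigr => l _; rewrite coef_dotC.
have -> a (p q : {poly R[i]}) d : coef_dot d (a *: p) q = a * coef_dot d p q.
  by rewrite /coef_dot big_distrr /=; apply: eq_bigr => i _; rewrite coefZ mulrA.
rewrite coef_dot_Xsub1; first by rewrite -/(szego_weight _ k n) !expr2; ring.
by have := leq_ord l; lia.
Qed.

End Bidisk.

Theorem lemma4p3 (R : realType) (k j : nat) (hk : (1 <= k)%N) (hj : (1 <= j)%N) :
  ((fun n : nat => alpha R k j n : R[i]^o) =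
     (fun n : nat => - (k%:R / (n + k)%:R) + (k * j)%:R / (n + k)%:R ^+ 2)
     +O_\oo (fun n : nat => n%:R ^- 3 : R[i]^o))
  /\
  ((fun n : nat => `|alpha R k j n| ^+ 2 - `|alpha R k j.+1 n| ^+ 2 : R[i]^o) =
     (fun n : nat => (2 * k ^ 2)%:R / (n + k)%:R ^+ 3)
     +O_\oo (fun n : nat => n%:R ^- 4 : R[i]^o)).
Proof.
(* Bounds in powers of 1/(n+k) pass to powers of 1/n because n <= n + k; starting at [n0.+1] keeps n
   positive. *)
have bigO_of_bound m (f g : nat -> R[i]) c : 0 <= c ->
    (exists n0, forall n, (n0 <= n)%N -> `|f n - g n| <= c / (n + k)%:R ^+ m) ->
    (f : nat -> R[i]^o) = (g : nat -> R[i]^o) +O_\oo (fun n : nat => n%:R ^- m : R[i]^o).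
  move=> c0 [n0 fg]; apply/eqaddOP; exists c; split; first exact: ger0_real.
  move=> C cC; exists n0.+1 => // n /= nn.
  apply: le_trans (fg _ (ltnW nn)) _.
  have n_gt0 : 0 < n%:R :> R[i] by rewrite ltr0n (leq_ltn_trans _ nn).
  rewrite ger0_norm; last by rewrite invr_ge0 exprn_ge0.
  apply: ler_pM => //; first exact: ltW.
  rewrite lef_pV2 ?posrE ?exprn_gt0//; last by rewrite ltr0n addn_gt0 hk orbT.
  by rewrite lerXn2r ?nnegrE ?ler0n// ler_nat leq_addr.
have x0 n : 0 <= (n + k)%:R^-1 :> R[i] by rewrite invr_ge0.
have [f fE aE] := expands_szego_alpha R[i] hk hj.
have [g gE bE] := expands_szego_alpha R[i] hk (isT : (0 < j.+1)%N).
split.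
  have [c c0 [n0 fc]] := fE.
  apply: (bigO_of_bound _ _ _ (k%:R * c)); first exact: mulr_ge0.
  exists n0 => n /fc {}fc; rewrite alpha_szego// aE.
  have -> : - (k%:R / (n + k)%:R) * f n -
      (- (k%:R / (n + k)%:R) + (k * j)%:R / (n + k)%:R ^+ 2) =
      - (k%:R / (n + k)%:R * (f n - (1 + - j%:R / (n + k)%:R))) :> R[i].
    by rewrite natrM -exprVn; ring.
  rewrite normrN normrM ger0_norm ?mulr_ge0// -mulrA -[leRHS]mulrA ler_wpM2l//.
  have -> : c / (n + k)%:R ^+ 3 = (n + k)%:R^-1 * (c / (n + k)%:R ^+ 2).
    by rewrite -!exprVn; ring.
  by rewrite ler_wpM2l.
have real_alpha i n : (0 < i)%N -> `|alpha R k i n| ^+ 2 = alpha R k i n ^+ 2.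
  by case: i => // i _; rewrite alpha_szego// real_normK ?szego_alphaS_real.
(* The expansion of f^2 - g^2 has constant term 0 and first-order coefficient -2j + 2(j+1) = 2; the
   factor k^2/(n+k)^2 then gives the main term. *)
have [c c0 [n0 hc]] := expandsD (expandsM hk fE fE)
  (expandsM hk (expands_cst k (-1)) (expandsM hk gE gE)).
apply: (bigO_of_bound _ _ _ (k%:R ^+ 2 * c)); first by rewrite mulr_ge0 ?exprn_ge0.
exists n0 => n /hc {}hc; rewrite !real_alpha// !alpha_szego// aE bE.
set h := (X in `|X| <= _) in hc.
have -> : (- (k%:R / (n + k)%:R) * f n) ^+ 2 - (- (k%:R / (n + k)%:R) * g n) ^+ 2 -
    (2 * k ^ 2)%:R / (n + k)%:R ^+ 3 = (k%:R / (n + k)%:R) ^+ 2 * h :> R[i].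
  by rewrite /h natrM natrX -!exprVn -[j.+1%:R]natr1; ring.
rewrite normrM ger0_norm; last by rewrite exprn_ge0// mulr_ge0.
have -> : k%:R ^+ 2 * c / (n + k)%:R ^+ 4 =
    (k%:R / (n + k)%:R) ^+ 2 * (c / (n + k)%:R ^+ 2) :> R[i].
  by rewrite -!exprVn; ring.
by rewrite ler_wpM2l// exprn_ge0// mulr_ge0.
Qed.
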